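(* Let $m \equiv 3 \pmod 4$ and $n \equiv 1 \pmod 4$ be two distinct square-free positive integers, and let $K = \mathbb{Q}(\sqrt{-m},\sqrt{n})$. For distinct primes $p, q, r$, the following hold: (I) If $m = p$ with $p \equiv 3 \pmod 8$, then $g(\mathcal{O}_K) = 3$. (II) If $m = pq$ with $p \equiv 3 \pmod 8$, $q \equiv 1 \pmod 8$ and $\left(\frac{p}{q}\right) = -1$, then $g(\mathcal{O}_K) = 3$. (III) If $m = pqr$ with $p \equiv q \equiv r \equiv 3 \pmod 8$ and $\left(\frac{p}{q}\right) = \left(\frac{q}{r}\right) = \left(\frac{r}{p}\right) = -1$, then $g(\mathcal{O}_K) = 3$.
   Context: For a number field $K$, $\mathcal{O}_K$ denotes its ring of integers. $g(\mathcal{O}_K)$ is the smallest positive integer $t$ such that every element of $\mathcal{O}_K$ is a sum of $t$ squares of elements of $\mathcal{O}_K$ (zero summands allowed). $\left(\frac{\cdot}{\cdot}\right)$ is the Legendre symbol. *)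

(* Defs.v *)
From mathcomp Require Import all_boot all_order all_algebra all_field.

Set Implicit Arguments.
Unset Strict Implicit.
Unset Printing Implicit Defensive.

Import GRing.Theory.
Local Open Scope ring_scope.

(* No positivity side condition is needed: 0 is excluded, since 2 ^ 2 %| 0. *)
Definition squarefree (n : nat) : Prop :=
  forall d : nat, (d ^ 2 %| n)%N -> d = 1%N.

(* Only meaningful when p is an odd prime. *)
Definition legendre (a : int) (p : nat) : int :=
  if (p%:Z %| a)%Z then 0
  else if [exists x : 'I_p, ((x%:Z ^+ 2)%R == a %[mod p%:Z])%Z] then 1
  else -1.

Section RingOfIntegers.

Variable K : fieldExtType rat.

Definition algebraic_integer (x : K) : Prop :=
  integralOver (intr : int -> K) x.

(* Repeated and zero f i are allowed, so this is monotone in t. *)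
Definition sum_of_integer_squares (t : nat) (x : K) : Prop :=
  exists f : 'I_t -> K,
    (forall i, algebraic_integer (f i)) /\ x = \sum_(i < t) f i ^+ 2.

Definition all_integers_sums_of (t : nat) : Prop :=
  forall x : K, algebraic_integer x -> sum_of_integer_squares t x.

(* g(O_K) = t, as a relation because a priori no such t need exist. *)
Definition g_integers_eq (t : nat) : Prop :=
  [/\ (0 < t)%N, all_integers_sums_of t
    & forall s : nat, (0 < s)%N -> all_integers_sums_of s -> (t <= s)%N].

(* K = Q(sqrt a, sqrt b), up to isomorphism over Q *)
Definition generated_by_sqrts (a b : rat) : Prop :=
  exists u v : K,
    [/\ u ^+ 2 = a%:A, v ^+ 2 = b%:A & <<1 & [:: u; v]>>%VS = fullv].

End RingOfIntegers.

(* Main.v *)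
(* Every integer of K has x^4 = x mod 2, because 2 is unramified in K and its
   residue fields lie in F_4.  If -1 = a^2 + b^2 with a, b integral, then (1, a, b)
   is isotropic for the sum of three squares, and translating a solution of the
   congruence modulo 2 along it gives an exact solution.  On the other hand
   sqrt(-m) is not a sum of two squares, by a computation modulo 4.

   A representation -1 = a^2 + b^2 comes from a solution of m y^2 = x^2 + 2 in odd
   integers, with a, b = (y sqrt(-m) +- x) / 2.  Legendre's descent on Pell's
   equation T^2 - m U^2 = 1 ends in D r^2 - E s^2 = 1 or 2 with D E = m, and the
   residue conditions exclude every case except D = m, E = 1 with value 2. *)
Require Import Defs.
From mathcomp Require Import all_boot all_order all_algebra all_field.
From mathcomp Require Import zify ring.
Set Implicit Arguments.
Unset Strict Implicit.
Unset Printing Implicit Defensive.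
Import Order.TTheory GRing.Theory Num.Theory.
Local Open Scope ring_scope.

(** * Solvability of Pell's equation, by the Stern-Brocot search for the square root of m *)

(** The fractions p/r and q/s enclose the square root of m from above and below; their mediant
    replaces the one on its own side. The search starts from 1/0 and 0/1. *)
Definition mediant_step (m : int) (w : int * int * int * int) :=
  let: (p, q, r, s) := w in
  if m * (r + s) ^+ 2 < (p + q) ^+ 2 then (p + q, q, r + s, s)
  else (p, p + q, r, r + s).

Definition mediant_inv (m : int) (w : int * int * int * int) : Prop :=
  let: (p, q, r, s) := w in
  [/\ 0 < p, 0 <= q, 0 <= r, 0 < s
    & [/\ p * s - q * r = 1, m * r ^+ 2 < p ^+ 2 & q ^+ 2 < m * s ^+ 2]].

Lemma mediant_step_inv (m : int) w :
  (forall x y : int, 0 < y -> x ^+ 2 <> m * y ^+ 2) ->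
  mediant_inv m w -> mediant_inv m (mediant_step m w).
Proof.
move=> nsq; case: w => [[[p q] r] s] [p0 q0 r0 s0 [det hp hq]] /=.
case: ifP => [lt|/negbT]; first by split; try split; lia.
rewrite -leNgt le_eqVlt => /orP[/eqP /nsq|lt]; first by case; lia.
by split; try split; lia.
Qed.

(** The strictly growing entry sum shows that the search never returns to an earlier matrix. *)
Lemma mediant_step_sum (m : int) p q r s :
  mediant_inv m (p, q, r, s) ->
  let: (p', q', r', s') := mediant_step m (p, q, r, s) in
  p + q + r + s < p' + q' + r' + s'.
Proof. by case=> p0 q0 r0 s0 _ /=; case: ifP; lia. Qed.

(* The values of the form x^2 - m y^2 at the two columns of w, and half its
   polarization: they determine the form in the basis w. *)
Definition mediant_form (m : int) (w : int * int * int * int) :=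
  let: (p, q, r, s) := w in
  (p ^+ 2 - m * r ^+ 2, p * q - m * (r * s), m * s ^+ 2 - q ^+ 2).

(** A basis change of determinant 1 preserves the discriminant, so b^2 + a c = m. With a and c
    positive, this leaves finitely many forms. *)
Lemma mediant_form_bound (m : int) w a b c :
  mediant_inv m w -> mediant_form m w = (a, b, c) ->
  [/\ 0 <= a <= m, - m <= b <= m & 0 <= c <= m].
Proof.
case: w => [[[p q] r] s] [p0 q0 r0 s0 [det hp hq]] [<- <- <-].
set a' := p ^+ 2 - m * r ^+ 2; set b' := p * q - m * (r * s); set c' := m * s ^+ 2 - q ^+ 2.
have E : b' ^+ 2 + a' * c' = m.
  have -> : b' ^+ 2 + a' * c' = m * (p * s - q * r) ^+ 2 by rewrite /b' /a' /c'; ring.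
  by rewrite det expr1n mulr1.
have a0 : 0 < a' by rewrite subr_gt0.
have c0 : 0 < c' by rewrite subr_gt0.
move: a' b' c' E a0 c0 => a' b' c' E a0 c0.
have ac : 0 < a' * c' by apply: mulr_gt0.
by split; apply/andP; split; nia.
Qed.

Lemma pos_dvd_le (x y : int) : 0 < x -> 0 < y -> (exists k, x * k = y) -> x <= y.
Proof. by move=> x0 + [k Ek]; rewrite -Ek pmulr_rgt0 // => k0; rewrite ler_pMr //; lia. Qed.

(** Determinant 1 makes both bottom rows primitive, so proportional rows divide each other and
    coincide. The outer coefficients of the form then fix p and q up to sign. *)
Lemma mediant_form_inj (m : int) p q r s p' q' r' s' :
  mediant_inv m (p, q, r, s) -> mediant_inv m (p', q', r', s') ->
  mediant_form m (p, q, r, s) = mediant_form m (p', q', r', s') ->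
  r' * s = s' * r -> (p, q, r, s) = (p', q', r', s').
Proof.
move=> [p0 q0 r0 s0 [det hp hq]] [p0' q0' r0' s0' [det' hp' hq']] [Ea Eb Ec] Ers.
have r_dvd : r * (p * s' - q * r') = r'.
  have -> : r * (p * s' - q * r') = r' * (p * s - q * r) + p * (s' * r - r' * s) by ring.
  by rewrite det Ers subrr mulr0 addr0 mulr1.
have r_dvd' : r' * (p' * s - q' * r) = r.
  have -> : r' * (p' * s - q' * r) = r * (p' * s' - q' * r') + p' * (r' * s - s' * r) by ring.
  by rewrite det' Ers subrr mulr0 addr0 mulr1.
have s_dvd : s * (p * s' - q * r') = s'.
  have -> : s * (p * s' - q * r') = s' * (p * s - q * r) + q * (s' * r - r' * s) by ring.
  by rewrite det Ers subrr mulr0 addr0 mulr1.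
have s_dvd' : s' * (p' * s - q' * r) = s.
  have -> : s' * (p' * s - q' * r) = s * (p' * s' - q' * r') + q' * (r' * s - s' * r) by ring.
  by rewrite det' Ers subrr mulr0 addr0 mulr1.
have Es : s' = s.
  apply/le_anti/andP; split; apply: pos_dvd_le => //.
  - by exists (p' * s - q' * r).
  - by exists (p * s' - q * r').
have Er : r' = r.
  by rewrite Es [s * r]mulrC in Ers; apply: (mulIf _ Ers); rewrite gt_eqF.
rewrite Es Er in Ea Ec *.
have -> : p = p'.
  by apply/eqP; rewrite -(@eqrXn2 _ 2) ?ltW //; apply/eqP; move/addIr: Ea.
have -> // : q = q'.
  by apply/eqP; rewrite -(@eqrXn2 _ 2) //; apply/eqP; move/addrI/oppr_inj: Ec.
Qed.

Lemma inord_absz_inj (N : nat) (a b : int) :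
  inord (absz a) = inord (absz b) :> 'I_N.+1 ->
  0 <= a <= N%:Z -> 0 <= b <= N%:Z -> a = b.
Proof. by move/(congr1 val) => /= + ha hb; rewrite !inordK; lia. Qed.

(** Pigeonhole: two different bases met by the search carry the same form, and the passage from one
    to the other is an automorphism of x^2 - m y^2. *)
Lemma pell_solution (m : int) :
  0 < m -> (forall x y : int, 0 < y -> x ^+ 2 <> m * y ^+ 2) ->
  exists T U : int, 0 < U /\ T ^+ 2 = m * U ^+ 2 + 1.
Proof.
move=> m0 nsq; pose w i := iter i (mediant_step m) (1, 0, 0, 1).
have winv i : mediant_inv m (w i).
  by elim: i => [|i IH]; [split=> //; split; lia | apply: mediant_step_inv].
pose sum (v : int * int * int * int) := let: (p, q, r, s) := v in p + q + r + s.
have wsum i j : (i < j)%N -> sum (w i) < sum (w j).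
  elim: j => // j IH; rewrite ltnS => le_ij.
  have lt : sum (w j) < sum (w j.+1).
    have := winv j; rewrite /= -/(w j); case: (w j) => [[[p q] r] s].
    by move/mediant_step_sum; case: (mediant_step _ _) => [[[? ?] ?] ?].
  by case: ltngtP le_ij => // [/IH|->] // h _; lia.
(* The middle coefficient lies in [-m, m]; shifting it by m makes it a natural number up to 2m. One
   index more than there are codes forces a collision. *)
pose N := (absz m).*2.
pose code (i : 'I_(N.+1 ^ 3).+1) : 'I_N.+1 * 'I_N.+1 * 'I_N.+1 :=
  let: (a, b, c) := mediant_form m (w i) in
  (inord (absz a), inord (absz (b + m)), inord (absz c)).
have : ~~ injectiveb code.
  apply/negP => /injectiveP /leq_card.
  by rewrite !card_prod !card_ord !expnS expn0 muln1 mulnA ltnn.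
case/injectivePn=> i [j neq_ij Ecode].
wlog lt_ij : i j neq_ij Ecode / (i < j)%N.
  move=> IH; case: (ltngtP i j) => [/IH|/IH|]; first exact.
  - by apply; rewrite 1?eq_sym.
  - by move/val_inj=> eq_ij; rewrite eq_ij eqxx in neq_ij.
have Eform : mediant_form m (w i) = mediant_form m (w j).
  move: Ecode; rewrite /code.
  case Ei: (mediant_form m (w i)) => [[a b] c].
  case Ej: (mediant_form m (w j)) => [[a' b'] c'].
  have [ha hb hc] := mediant_form_bound (winv i) Ei.
  have [ha' hb' hc'] := mediant_form_bound (winv j) Ej.
  have le_N : N = (absz m).*2 by [].
  clear - m0 le_N ha hb hc ha' hb' hc'; clearbody N.
  case=> /inord_absz_inj Ea /inord_absz_inj Eb /inord_absz_inj Ec.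
  congr (_, _, _); first (by apply: Ea; lia); last by apply: Ec; lia.
  by apply: (addIr m); apply: Eb; lia.
have neq_w : w i <> w j by move=> eq_w; have := wsum _ _ lt_ij; rewrite eq_w ltxx.
have := winv i; have := winv j; move: Eform neq_w.
case: (w i) (w j) => [[[p q] r] s] [[[p' q'] r'] s'] Eform neq_w hj hi.
have neq_rs : r' * s <> s' * r.
  by move=> h; apply: neq_w; apply: (mediant_form_inj hi hj Eform h).
case: Eform => Ea Eb Ec; case: hi => _ _ _ _ [det _ _].
(* Up to the sign of the second entry, this is the first column of [w j] times the inverse of
   [w i]. *)
exists (p' * s - q' * r), `|r' * s - s' * r|; split.
  by rewrite normr_gt0 subr_eq0; apply/eqP.
rewrite real_normK ?num_real //.
have -> : (p' * s - q' * r) ^+ 2 = m * (r' * s - s' * r) ^+ 2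
   + ((p' ^+ 2 - m * r' ^+ 2) * s ^+ 2 - 2 * (p' * q' - m * (r' * s')) * r * s
     - (m * s' ^+ 2 - q' ^+ 2) * r ^+ 2) by ring.
rewrite -Ea -Eb -Ec; congr (_ + _).
by transitivity ((p * s - q * r) ^+ 2); [ring | rewrite det].
Qed.

(** * Coprime factorizations and Legendre's descent *)

Lemma gcdn_sqr (a b : nat) : gcdn (a ^ 2) (b ^ 2) = (gcdn a b ^ 2)%N.
Proof.
case: (posnP a) => [->|a0]; first by rewrite exp0n // !gcd0n.
have g0 : (0 < gcdn a b)%N by rewrite gcdn_gt0 a0.
have /dvdnP[a' Ea] := dvdn_gcdl a b; have /dvdnP[b' Eb] := dvdn_gcdr a b.
have cop : coprime a' b'.
  by rewrite /coprime -(eqn_pmul2r g0) muln_gcdl -Ea -Eb mul1n.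
move: (gcdn a b) Ea Eb => g -> ->.
by rewrite !expnMn -muln_gcdl (eqP (coprimeXl 2 (coprimeXr 2 cop))) mul1n.
Qed.

(** gcd(x, u)^2 = gcd(x^2, x y) = x gcd(x, y) = x. *)
Lemma coprime_mul_eq_sqr (x y u : nat) :
  coprime x y -> (x * y = u ^ 2)%N -> x = (gcdn x u ^ 2)%N.
Proof.
move=> cop E; rewrite -gcdn_sqr -E expnS expn1 -muln_gcdr.
by rewrite (eqP cop) muln1.
Qed.

(** Take D = gcd(x, m) and E = m / D. Then E is coprime to x / D, hence divides y, and the coprime
    cofactors x / D and y / E multiply to u^2. *)
Lemma coprime_mul_eq_mul_sqr (m x y u : nat) :
  (0 < m)%N -> coprime x y -> (x * y = m * u ^ 2)%N ->
  exists D E r s : nat,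
    [/\ (D * E = m)%N, (r * s = u)%N, (x = D * r ^ 2)%N & (y = E * s ^ 2)%N].
Proof.
move=> m0 cop; set D := gcdn x m.
have D0 : (0 < D)%N by rewrite gcdn_gt0 m0 orbT.
have Ex : x = (D * (x %/ D))%N by rewrite mulnC divnK ?dvdn_gcdl.
have Em : m = (D * (m %/ D))%N by rewrite mulnC divnK ?dvdn_gcdr.
move: (x %/ D)%N (m %/ D)%N Ex Em => x' E Ex Em.
have copE : coprime E x'.
  by rewrite coprime_sym /coprime -(eqn_pmul2l D0) muln_gcdr -Ex -Em muln1.
have E0 : (0 < E)%N by move: m0; rewrite Em muln_gt0 => /andP[].
rewrite {1}Ex {1}Em -!mulnA => /eqP; rewrite eqn_pmul2l // => /eqP Eu.
have : (E %| y)%N by rewrite -(Gauss_dvdr _ copE) Eu dvdn_mulr.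
case/dvdnP=> y' Ey; rewrite mulnC in Ey.
have /eqP : (E * (x' * y') = E * u ^ 2)%N by rewrite mulnCA -Ey.
rewrite eqn_pmul2l // => /eqP Exy.
have cop' : coprime x' y'.
  apply: (coprime_dvdl (n := x)); first by rewrite Ex dvdn_mull.
  by apply: (coprime_dvdr (n := y)) => //; rewrite Ey dvdn_mull.
have Ex' := coprime_mul_eq_sqr cop' Exy.
have Ey' : y' = (gcdn y' u ^ 2)%N.
  by apply: (@coprime_mul_eq_sqr _ x'); rewrite 1?coprime_sym 1?mulnC.
exists D, E, (gcdn x' u), (gcdn y' u); split=> //; last by rewrite -Ey'.
- by apply/eqP; rewrite -(eqn_exp2r _ _ (isT : 0 < 2)%N) expnMn -Ex' -Ey' Exy.
- by rewrite -Ex'.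
Qed.

(** Value 1 comes from odd T in Pell's equation, value 2 from even T. With D = 1 the first
    alternative would be Pell's equation itself. *)
Definition unit_or_two_split (m : nat) : Prop :=
  exists D E r s : nat, (D * E = m)%N /\
    ((D * r ^ 2 = E * s ^ 2 + 1)%N /\ D <> 1%N \/
     [/\ (D * r ^ 2 = E * s ^ 2 + 2)%N, odd r & odd s]).

(* Legendre's descent: m U^2 = (T - 1)(T + 1) splits up to the factor
   gcd(T - 1, T + 1) = 1 or 2, and the split D = 1 is a smaller solution. *)
Lemma pell_split (m T U : nat) :
  odd m -> (0 < U)%N -> (T ^ 2 = m * U ^ 2 + 1)%N -> unit_or_two_split m.
Proof.
move=> m_odd; elim/ltn_ind: U T => U IH T U0 ET.
have m0 : (0 < m)%N by case: (m) m_odd.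
have [k ET2] : exists k, T = k.+2.
  by case: T ET => [|[|k]] ET; [lia | exfalso; nia | exists k].
case: (boolP (odd T)) => T_odd.
  (* For odd T the factors are halved: (T + 1)/2 and (T - 1)/2 are consecutive, hence coprime, with
     product m (U/2)^2. *)
  have [t Et] : exists t, T = (t.*2).+1 by exists T./2; lia.
  have U_even : ~~ odd U.
    have : odd (T ^ 2) by rewrite oddX T_odd orbT.
    by rewrite ET oddD oddM oddX m_odd /=; case: (odd U).
  have [v Ev] : exists v, U = v.*2 by exists U./2; lia.
  have Etv : (t.+1 * t = m * v ^ 2)%N by move: ET; rewrite Et Ev; lia.
  case: (coprime_mul_eq_mul_sqr m0 (coprimeSn t) Etv) => D [E [r [s [EDE Ers Et1 Et2]]]].
  have Hrs : (D * r ^ 2 = E * s ^ 2 + 1)%N by rewrite -Et1 -Et2 addn1.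
  case: (D =P 1%N) => [D1|D1]; last by exists D, E, r, s; split=> //; left.
  rewrite D1 !mul1n in Hrs EDE; rewrite EDE in Hrs Et2.
  have s0 : (0 < s)%N by case: s Et2 {Ers Hrs} => //; nia.
  have r0 : (0 < r)%N by case: r Hrs {Ers Et1} => //; lia.
  apply: (IH s _ r) => //; rewrite Ev -Ers -addnn.
  by have := leq_pmull s r0; lia.
(* For even T the factors T + 1 and T - 1 are odd and differ by 2, hence are coprime without
   halving. *)
have [t Et] : exists t, T = t.*2.+2 by exists k./2; lia.
have cop : coprime t.*2.+3 t.*2.+1.
  have := gcdnDl t.*2.+1 2; rewrite addn2 gcdnC /coprime => ->.
  by rewrite -/(coprime _ _) coprimen2 /= odd_double.
have EtU : (t.*2.+3 * t.*2.+1 = m * U ^ 2)%N by move: ET; rewrite Et; lia.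
case: (coprime_mul_eq_mul_sqr m0 cop EtU) => D [E [r [s [EDE Ers Et1 Et2]]]].
have U_odd : odd U.
  have : odd (m * U ^ 2) by rewrite -EtU oddM /= odd_double.
  by rewrite oddM oddX m_odd.
move: U_odd; rewrite -Ers oddM => /andP[r_odd s_odd].
by exists D, E, r, s; split=> //; right; split=> //; rewrite -Et1 -Et2 addn2.
Qed.

Lemma nonsquare_split (m : nat) :
  odd m -> (forall x y : nat, (0 < y)%N -> (x ^ 2)%N <> (m * y ^ 2)%N) ->
  unit_or_two_split m.
Proof.
move=> m_odd nsq; have m0 : (0 < m)%N by case: (m) m_odd.
have [//||T [U [U0 ETU]]] := @pell_solution m.
  move=> x y y0 E; apply: (nsq (absz x) (absz y)); first by lia.
  have : (absz (x ^+ 2) = absz (m%:Z * y ^+ 2)) by rewrite E.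
  by rewrite abszM !abszX absz_nat.
apply: (@pell_split m (absz T) (absz U)) => //; first by lia.
by have := congr1 absz ETU; rewrite abszX => ->; lia.
Qed.

(** * Squares in prime fields and local obstructions to the splits *)

Lemma eq_quot_sqr (F : fieldType) (a x c : F) :
  c != 0 -> a * x ^+ 2 = c ^+ 2 -> exists y, y ^+ 2 = a.
Proof.
move=> c0 E; have x0 : x != 0.
  by apply: contra_eq_neq E => ->; rewrite expr0n mulr0 eq_sym expf_eq0.
by exists (c / x); rewrite expr_div_n -E mulfK // expf_neq0.
Qed.

Lemma legendre_nonsquare (a p : nat) :
  prime p -> legendre a p = -1 -> forall x : 'F_p, x ^+ 2 <> a%:R.
Proof.
move=> p_pr + x Ex; rewrite /legendre; case: ifP => // _; case: ifP => //.
move/negbT/negP=> nex _; apply: nex; apply/existsP.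
have xp : (x < p)%N by have := ltn_ord x; rewrite {2}Fp_cast.
exists (Ordinal xp) => /=.
have Ea : ((x : nat) ^ 2 = a %[mod p])%N.
  have := congr1 val Ex; rewrite -[x in x ^+ 2]natr_Zp -natrX /=.
  by rewrite !val_Fp_nat.
rewrite (_ : (x : nat)%:Z ^+ 2 = ((x : nat) ^ 2)%N%:Z) ?rmorphXn //.
by rewrite !modz_nat eqz_nat Ea.
Qed.

Lemma natr_Fp_neq0 (p n : nat) : prime p -> ~~ (p %| n)%N -> n%:R != 0 :> 'F_p.
Proof. by move=> p_pr; rewrite -(dvdn_pcharf (pchar_Fp p_pr)). Qed.

Lemma two_Fp_neq0 (p : nat) : prime p -> odd p -> 2%:R != 0 :> 'F_p.
Proof.
move=> p_pr p_odd; apply: natr_Fp_neq0 => //.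
by rewrite dvdn_prime2 //; apply: contraL p_odd => /eqP->.
Qed.

Lemma expf_Fp (p : nat) (x : 'F_p) : prime p -> x ^+ p = x.
Proof. by move=> p_pr; have := expf_card x; rewrite card_Fp. Qed.

(** For p = 4k + 3, x^2 = -1 gives x = x^p = (-1)^(2k+1) x = -x, so x = 0. *)
Lemma sqr_Fp_neqN1 (p : nat) (x : 'F_p) :
  prime p -> p = 3 %[mod 4] -> x ^+ 2 <> -1.
Proof.
move=> p_pr p4 Ex; have [k Ep] : exists k, p = (2 * k.*2.+1).+1.
  by exists (p %/ 4)%N; lia.
have Nx : - x = x.
  have : x ^+ (2 * k.*2.+1).+1 = x by rewrite -Ep expf_Fp.
  by rewrite exprSr exprM Ex -signr_odd /= odd_double expr1 mulN1r.
have : 2%:R * x = 0 by rewrite mulr_natl mulr2n -{1}Nx addNr.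
move/eqP; rewrite mulf_eq0 (negPf (two_Fp_neq0 p_pr _)); last by lia.
move=> /eqP x0; move: Ex; rewrite x0 expr0n /= => /eqP.
by rewrite eq_sym oppr_eq0 oner_eq0.
Qed.

(** For q = 8k + 1 the polynomial X^(4k) - 1 has too few roots to vanish at all nonzero y. Where it
    does not vanish, y^(4k) is a square root of 1 other than 1, and z = y^k works. *)
Lemma Fp_fourth_root_N1 (q : nat) :
  prime q -> q = 1 %[mod 8] -> exists z : 'F_q, z ^+ 4 = -1.
Proof.
move=> q_pr q8; have q1 := prime_gt1 q_pr.
have [k Eq] : exists k, q = (k * 8).+1 by exists (q %/ 8)%N; lia.
have k0 : (0 < k)%N by lia.
pose P : {poly 'F_q} := 'X^(k * 4) - 1.
have sP : size P = (k * 4).+1 by rewrite size_XnsubC // muln_gt0 k0.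
have : ~~ [forall y : 'F_q, (y != 0) ==> root P y].
  apply/negP=> /forallP rootP.
  have := @max_poly_roots _ P (enum (predC1 (0 : 'F_q))).
  rewrite -size_poly_gt0 sP -cardE cardC1 card_Fp // enum_uniq /=.
  have -> : all (root P) (enum (predC1 (0 : 'F_q))).
    by apply/allP => y; rewrite mem_enum inE; apply/implyP/rootP.
  by move=> /(_ isT isT isT); clear - Eq k0; lia.
case/forallPn=> y; rewrite negb_imply => /andP[y0 ny].
exists (y ^+ k); rewrite -exprM.
have : (y ^+ (k * 4)) ^+ 2 == 1.
  rewrite -exprM -mulnA; apply/eqP/(mulIf y0).
  by rewrite mul1r -exprSr -[(4 * 2)%N]/8%N -Eq expf_Fp.
rewrite sqrf_eq1 => /orP[y1|/eqP //].
by case/negP: ny; rewrite rootE !hornerE (eqP y1) subrr.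
Qed.

Lemma sqr_mod4 (r : nat) : (r ^ 2 %% 4)%N = odd r.
Proof.
have Er : r = (odd r + r./2 * 2)%N by rewrite muln2 odd_double_half.
by case: (odd r) Er => /= ->; rewrite expnS expn1 -modnMm ?modnMDl; lia.
Qed.

Lemma sqr_odd_mod8 (r : nat) : odd r -> (r ^ 2 %% 8)%N = 1%N.
Proof.
move=> r_odd; have Er : r = (1 + r./2 * 2)%N by have := odd_double_half r; lia.
have : ~~ odd (r./2 * r./2.+1) by rewrite oddM /= andbN.
move: (r./2) Er => h ->; rewrite -dvdn2 => /dvdnP[j Ej].
have -> : ((1 + h * 2) ^ 2 = j * 8 + 1)%N by move: Ej; lia.
by rewrite modnMDl.
Qed.

(** Modulo 4 the left side is 0 or 3, the right side 1 or 2. *)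
Lemma unit_split_mod4 (D E r s : nat) :
  D = 3 %[mod 4] -> E = 1 %[mod 4] -> (D * r ^ 2)%N <> (E * s ^ 2 + 1)%N.
Proof.
move=> D4 E4 /(congr1 (modn^~ 4%N)) /=.
rewrite -modnDml -modnMm -[((E * _) %% _)%N]modnMm D4 E4 !sqr_mod4.
by case: (odd r) (odd s) => [] [].
Qed.

Lemma two_split_mod8 (D E r s : nat) :
  (D * r ^ 2 = E * s ^ 2 + 2)%N -> odd r -> odd s -> D = E + 2 %[mod 8].
Proof.
move=> H r_odd s_odd; have := congr1 (modn^~ 8%N) H => /=.
rewrite -modnDml -modnMmr -[((E * _) %% _)%N]modnMmr !sqr_odd_mod8 //.
by rewrite !muln1 modnDml.
Qed.

(** Applied to one prime after another, this enumerates the factorizations D E = m. *)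
Lemma prime_mul_split (p n D E : nat) :
  prime p -> (D * E = p * n)%N ->
  (exists2 D', D = (p * D')%N & (D' * E)%N = n) \/
  (exists2 E', E = (p * E')%N & (D * E')%N = n).
Proof.
move=> p_pr H; have p0 := prime_gt0 p_pr.
have : (p %| D * E)%N by rewrite H dvdn_mulr.
rewrite Euclid_dvdM // => /orP[] /dvdnP[k Ek]; [left|right]; exists k;
  rewrite 1?mulnC //; apply/eqP; rewrite -(eqn_pmul2l p0) -H Ek; apply/eqP; lia.
Qed.

(** The exponent of p is even on the left and odd on the right. *)
Lemma prime_mul_nonsquare (p n x y : nat) :
  prime p -> ~~ (p %| n)%N -> (0 < y)%N -> (x ^ 2)%N <> (p * n * y ^ 2)%N.
Proof.
move=> p_pr pn y0 E; have p0 := prime_gt0 p_pr.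
have n0 : (0 < n)%N by case: n pn {E} => //; rewrite dvdn0.
have l1 : logn p p = 1%N by rewrite logn_prime // eqxx.
have := congr1 (logn p) E.
rewrite lognM ?muln_gt0 ?p0 ?expn_gt0 ?y0 // lognM // !lognX l1.
by rewrite (@logn_coprime p n) ?prime_coprime //; lia.
Qed.

(** * Solutions of m y^2 = x^2 + 2 in the three cases *)

Definition two_split (m : nat) : Prop :=
  exists x y : nat, [/\ odd x, odd y & (m * y ^ 2 = x ^ 2 + 2)%N].

(** Besides D = p with value 2, value 1 falls to the residues modulo 4 or to [D <> 1], and D = 1
    with value 2 would need 1 = 3 + 2 modulo 8. *)
Lemma two_split_prime (p : nat) : prime p -> p = 3 %[mod 8] -> two_split p.
Proof.
move=> p_pr p8.
have [||D [E [r [s [EDE]]]]] := @nonsquare_split p; first by lia.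
  move=> x y y0; rewrite -[p]muln1; apply: prime_mul_nonsquare => //.
  by rewrite dvdn1; lia.
rewrite -[p in RHS]muln1 in EDE.
have [[D' -> /eqP]|[E' -> /eqP]] := prime_mul_split p_pr EDE;
  rewrite muln_eq1 => /andP[/eqP -> /eqP ->]; rewrite ?muln1.
- case=> [[/unit_split_mod4 []]|[H r_odd s_odd]]; try lia.
  by exists s, r; rewrite H mul1n.
- case=> [[_ []]|[H r_odd s_odd]] //.
  by have := two_split_mod8 H r_odd s_odd; lia.
Qed.

(** The solution of p v^2 = u^2 + 2 makes -2 a square modulo p; were 2 a square as well, so would be
    -1. *)
Lemma sqr_Fp_neq2 (p : nat) (x : 'F_p) :
  prime p -> p = 3 %[mod 8] -> x ^+ 2 <> 2%:R.
Proof.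
move=> p_pr p8 Ex; have [u [v [_ _ H]]] := two_split_prime p_pr p8.
have x0 : x != 0.
  have : x ^+ 2 != 0 by rewrite Ex two_Fp_neq0 //; lia.
  by rewrite expf_eq0.
have Eu : u%:R ^+ 2 = - x ^+ 2.
  by apply/eqP; rewrite -addr_eq0 Ex -natrX -natrD -H natrM pchar_Fp_0 ?mul0r.
apply: (@sqr_Fp_neqN1 p (u%:R / x)); [by []|by lia|].
by rewrite expr_div_n Eu mulNr divff // expf_neq0.
Qed.

(* Quadratic reciprocity for p = q = 3 mod 8, read off the descent for p q. *)
Lemma reciprocity_split (p q : nat) :
  prime p -> prime q -> p = 3 %[mod 8] -> q = 3 %[mod 8] ->
  (forall x : 'F_q, x ^+ 2 <> p%:R) ->
  exists a b : nat, (q * a ^ 2 = p * b ^ 2 + 1)%N.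
Proof.
move=> p_pr q_pr p8 q8 np.
have neq_pq : p <> q by move=> e; case: (np 0); rewrite e pchar_Fp_0 // expr0n.
have [||D [E [r [s [EDE]]]]] := @nonsquare_split (p * q); first by rewrite oddM; lia.
  by move=> x y; apply: prime_mul_nonsquare; rewrite ?dvdn_prime2 //; apply/eqP.
have pq8 : ((p * q) %% 8 = 1)%N by rewrite -modnMm p8 q8.
rewrite -[q in RHS]muln1 in EDE.
have [[D1 -> ED]|[E1 -> ED]] := prime_mul_split p_pr EDE;
  have [[D2 -> /eqP]|[E2 -> /eqP]] := prime_mul_split q_pr ED;
  rewrite muln_eq1 => /andP[/eqP -> /eqP ->]; rewrite ?muln1 => -[];
  (* Since p q = 1 modulo 8, D and E agree modulo 8 in every factorization, so value 2 never
     occurs. *)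
  try (by case=> H r_odd s_odd; have := two_split_mod8 H r_odd s_odd; lia).
- case=> /(congr1 (fun n => n%:R : 'F_p)).
  rewrite mul1n !(natrD, natrX, natrM) (pchar_Fp_0 p_pr) !mul0r => /esym/eqP.
  rewrite addr_eq0 => /eqP /sqr_Fp_neqN1 []; by [|lia].
- case=> /(congr1 (fun n => n%:R : 'F_q)).
  rewrite !(natrD, natrX, natrM) (pchar_Fp_0 q_pr) mul0r add0r => H.
  have [|y /np //] := @eq_quot_sqr 'F_q p%:R r%:R 1 (oner_neq0 _).
  by rewrite H expr1n.
- by case=> H _; exists r, s.
- by case=> _ [].
Qed.

(** Read modulo p, the split exhibits q as the inverse of a square. *)
Lemma reciprocity_sqr (p q : nat) :
  prime p -> prime q -> p = 3 %[mod 8] -> q = 3 %[mod 8] ->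
  (forall x : 'F_q, x ^+ 2 <> p%:R) -> exists y : 'F_p, y ^+ 2 = q%:R.
Proof.
move=> p_pr q_pr p8 q8 np.
have [a [b /(congr1 (fun n => n%:R : 'F_p))]] := reciprocity_split p_pr q_pr p8 q8 np.
rewrite !(natrD, natrX, natrM) (pchar_Fp_0 p_pr) mul0r add0r => H.
by apply: (@eq_quot_sqr 'F_p q%:R a%:R 1 (oner_neq0 _)); rewrite H expr1n.
Qed.

(** Modulo p the equation would read (y s)^2 = -1. *)
Lemma unit_split_sqr_mod (p D E r s : nat) (y : 'F_p) :
  prime p -> (p %| D)%N -> p = 3 %[mod 4] -> y ^+ 2 = E%:R ->
  (D * r ^ 2)%N <> (E * s ^ 2 + 1)%N.
Proof.
move=> p_pr /dvdnP[k ->] p4 Ey /(congr1 (fun n => n%:R : 'F_p)).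
rewrite !(natrD, natrX, natrM) (pchar_Fp_0 p_pr) mulr0 mul0r -Ey -exprMn.
by move=> /esym/eqP; rewrite addr_eq0 => /eqP; apply: sqr_Fp_neqN1.
Qed.

Lemma two_split_sqr_mod (p D E r s : nat) (y : 'F_p) :
  prime p -> (p %| E)%N -> p = 3 %[mod 8] -> y ^+ 2 = D%:R ->
  (D * r ^ 2)%N <> (E * s ^ 2 + 2)%N.
Proof.
move=> p_pr /dvdnP[k ->] p8 Ey /(congr1 (fun n => n%:R : 'F_p)).
rewrite !(natrD, natrX, natrM) (pchar_Fp_0 p_pr) mulr0 mul0r add0r -Ey -exprMn.
exact: sqr_Fp_neq2.
Qed.

(** With z^4 = -1 modulo q, both -1 and 2 are squares there. So p r^2 = 2 and p s^2 = -1 would each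
    make p a square modulo q; the other unwanted splits fail modulo 4, modulo 8 or by [D <> 1]. *)
Lemma two_split_mul (p q : nat) :
  prime p -> prime q -> p = 3 %[mod 8] -> q = 1 %[mod 8] ->
  (forall x : 'F_q, x ^+ 2 <> p%:R) -> two_split (p * q).
Proof.
move=> p_pr q_pr p8 q8 np; have [z Ez] := Fp_fourth_root_N1 q_pr q8.
have neq_pq : p <> q by move=> e; case: (np 0); rewrite e pchar_Fp_0 // expr0n.
have [||D [E [r [s [EDE]]]]] := @nonsquare_split (p * q); first by rewrite oddM; lia.
  by move=> x y; apply: prime_mul_nonsquare; rewrite ?dvdn_prime2 //; apply/eqP.
have pq8 : ((p * q) %% 8 = 3)%N by rewrite -modnMm p8 q8.
rewrite -[q in RHS]muln1 in EDE.
have [[D1 -> ED]|[E1 -> ED]] := prime_mul_split p_pr EDE;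
  have [[D2 -> /eqP]|[E2 -> /eqP]] := prime_mul_split q_pr ED;
  rewrite muln_eq1 => /andP[/eqP -> /eqP ->]; rewrite ?muln1.
- case=> [[/unit_split_mod4 []]|[H r_odd s_odd]]; try lia.
  by exists s, r; rewrite H mul1n.
- case=> [[/unit_split_mod4 []]|[H r_odd s_odd]]; try lia.
  have := congr1 (fun n => n%:R : 'F_q) H.
  rewrite !(natrD, natrX, natrM) (pchar_Fp_0 q_pr) mul0r add0r => {}H.
  (* As z^3 = -1/z, this is the usual square root z + 1/z of 2 for an eighth root of unity z. *)
  have Ez2 : (z - z ^+ 3) ^+ 2 = 2%:R.
    have -> : (z - z ^+ 3) ^+ 2 = z ^+ 2 + z ^+ 2 * z ^+ 4 - 2 * z ^+ 4 by ring.
    by rewrite Ez; ring.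
  have [||y /np //] := @eq_quot_sqr 'F_q p%:R r%:R (z - z ^+ 3); last by rewrite H Ez2.
  by have := two_Fp_neq0 q_pr; rewrite -Ez2 expf_eq0 /=; apply; lia.
- case=> [[H _]|[H r_odd s_odd]]; last first.
    by have := two_split_mod8 H r_odd s_odd; lia.
  have := congr1 (fun n => n%:R : 'F_q) H.
  rewrite !(natrD, natrX, natrM) (pchar_Fp_0 q_pr) mul0r => /esym/eqP.
  rewrite addr_eq0 => /eqP {}H.
  have [||y /np //] := @eq_quot_sqr 'F_q p%:R s%:R (z ^+ 2); last first.
    by rewrite H -exprM.
  apply/eqP => z0; move: Ez; rewrite -[4%N]/(2 * 2)%N exprM z0 expr0n /=.
  by move/eqP; rewrite eq_sym oppr_eq0 oner_eq0.
- case=> [[_ []]|[H r_odd s_odd]] //.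
  by have := two_split_mod8 H r_odd s_odd; lia.
Qed.

(** By reciprocity q is a square modulo p, r modulo q and p modulo r. After the tests modulo 4 and
    8, two primes in D leave only value 1, which makes -1 a square modulo one of them; one prime in
    D leaves only value 2, which makes 2 a square modulo a prime of E. *)
Lemma two_split_mul3 (p q r : nat) :
  prime p -> prime q -> prime r ->
  p = 3 %[mod 8] -> q = 3 %[mod 8] -> r = 3 %[mod 8] ->
  (forall x : 'F_q, x ^+ 2 <> p%:R) -> (forall x : 'F_r, x ^+ 2 <> q%:R) ->
  (forall x : 'F_p, x ^+ 2 <> r%:R) -> two_split (p * q * r).
Proof.
move=> p_pr q_pr r_pr p8 q8 r8 npq nqr nrp.
have neq_pq : p <> q by move=> e; case: (npq 0); rewrite e pchar_Fp_0 // expr0n.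
have neq_qr : q <> r by move=> e; case: (nqr 0); rewrite e pchar_Fp_0 // expr0n.
have neq_rp : r <> p by move=> e; case: (nrp 0); rewrite e pchar_Fp_0 // expr0n.
have [y1 Ey1] := reciprocity_sqr p_pr q_pr p8 q8 npq.
have [y2 Ey2] := reciprocity_sqr q_pr r_pr q8 r8 nqr.
have [y3 Ey3] := reciprocity_sqr r_pr p_pr r8 p8 nrp.
rewrite -mulnA.
have [||D [E [s [t [EDE]]]]] := @nonsquare_split (p * (q * r)).
- by rewrite !oddM; lia.
- move=> x y; apply: prime_mul_nonsquare => //.
  by rewrite Euclid_dvdM // !dvdn_prime2 //; apply/norP; split; apply/eqP; lia.
have m8 : ((p * (q * r)) %% 8 = 3)%N by rewrite -modnMm -[((q * r) %% 8)%N]modnMm p8 q8 r8.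
have pq8 : ((p * q) %% 8 = 1)%N by rewrite -modnMm p8 q8.
have pr8 : ((p * r) %% 8 = 1)%N by rewrite -modnMm p8 r8.
have qr8 : ((q * r) %% 8 = 1)%N by rewrite -modnMm q8 r8.
rewrite -[r in RHS]muln1 in EDE.
have [[D1 -> ED]|[E1 -> ED]] := prime_mul_split p_pr EDE;
  have [[D2 -> {}ED]|[E2 -> {}ED]] := prime_mul_split q_pr ED;
  have [[D3 -> /eqP]|[E3 -> /eqP]] := prime_mul_split r_pr ED;
  rewrite muln_eq1 => /andP[/eqP -> /eqP ->]; rewrite ?muln1;
  case=> [[H D1']|[H s_odd t_odd]];
  try (by have := two_split_mod8 H s_odd t_odd; lia);
  try (by case: (unit_split_mod4 _ _ H); lia); try by case: D1'.
- by exists t, s; rewrite H mul1n.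
- by case: (unit_split_sqr_mod q_pr _ _ Ey2 H); [rewrite dvdn_mull|lia].
- by case: (unit_split_sqr_mod p_pr _ _ Ey1 H); [rewrite dvdn_mulr|lia].
- by case: (two_split_sqr_mod r_pr _ r8 Ey3 H); rewrite !dvdn_mull.
- by case: (unit_split_sqr_mod r_pr _ _ Ey3 H); [rewrite dvdn_mull|lia].
- by case: (two_split_sqr_mod p_pr _ p8 Ey1 H); rewrite dvdn_mulr.
- by case: (two_split_sqr_mod q_pr _ q8 Ey2 H); rewrite dvdn_mull.
Qed.

(** * Fourth powers modulo 2 in a subring given by generators *)

(** The subring generated by [A]. It replaces an integral basis: in the application it has odd index
    in the integers locally, which suffices for congruences modulo 2. *)
Inductive zgen (R : pzRingType) (A : R -> Prop) : R -> Prop :=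
  | zgen_int (z : int) : zgen A z%:~R
  | zgen_base x : A x -> zgen A x
  | zgen_add x y : zgen A x -> zgen A y -> zgen A (x + y)
  | zgen_mul x y : zgen A x -> zgen A y -> zgen A (x * y).

Lemma zgen_opp (R : pzRingType) (A : R -> Prop) x : zgen A x -> zgen A (- x).
Proof. by move=> Sx; rewrite -mulN1r; apply: zgen_mul => //; apply: (zgen_int _ (- 1)). Qed.

Lemma zgen_nat (R : pzRingType) (A : R -> Prop) n : zgen A n%:R.
Proof. by rewrite -[n%:R]/(n%:Z%:~R); apply: zgen_int. Qed.

Lemma zgen_exp (R : pzRingType) (A : R -> Prop) x n : zgen A x -> zgen A (x ^+ n).
Proof.
move=> Sx; elim: n => [|n IH]; first by rewrite expr0; apply: (zgen_nat _ 1).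
by rewrite exprS; apply: zgen_mul.
Qed.

Lemma zgen_sum (R : pzRingType) (A : R -> Prop) n (f : 'I_n -> R) :
  (forall i, zgen A (f i)) -> zgen A (\sum_(i < n) f i).
Proof.
move=> Sf; apply: (big_ind (zgen A)) => //; last exact: zgen_add.
exact: (zgen_nat _ 0).
Qed.

(* The fourth power map is the square of Frobenius modulo 2, so it suffices to
   know it on generators. *)
Lemma zgen_exp4 (R : comPzRingType) (A : R -> Prop) :
  (forall x, A x -> exists2 y, zgen A y & x ^+ 4 = x + 2 * y) ->
  forall x, zgen A x -> exists2 y, zgen A y & x ^+ 4 = x + 2 * y.
Proof.
move=> hA x; elim=> {x} [z|x /hA //|x y Sx [u Su Eu] Sy [v Sv Ev]|x y Sx [u Su Eu] Sy [v Sv Ev]].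
- have [w Ew] : exists w : int, z ^+ 4 = z + 2 * w.
    have [t [->|->]] : exists t : int, z = 2 * t \/ z = 2 * t + 1.
    + by exists (z %/ 2)%Z; lia.
    + by exists (8 * t ^+ 4 - t); ring.
    + by exists (8 * t ^+ 4 + 16 * t ^+ 3 + 12 * t ^+ 2 + 3 * t); ring.
  by exists w%:~R; [exact: zgen_int | rewrite -rmorphXn Ew /= rmorphD rmorphM].
- exists (u + v + (2 * x ^+ 3 * y + 3 * x ^+ 2 * y ^+ 2 + 2 * x * y ^+ 3)).
    by repeat first [done | exact: zgen_nat | apply: zgen_add | apply: zgen_exp | apply: zgen_mul].
  have -> : (x + y) ^+ 4 = x ^+ 4 + y ^+ 4
    + 2 * (2 * x ^+ 3 * y + 3 * x ^+ 2 * y ^+ 2 + 2 * x * y ^+ 3) by ring.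
  by rewrite Eu Ev; ring.
- exists (x * v + u * y + 2 * u * v).
    by repeat first [done | exact: zgen_nat | apply: zgen_add | apply: zgen_mul].
  by rewrite exprMn Eu Ev; ring.
Qed.

Lemma zgen_exp4X (R : comPzRingType) (A : R -> Prop) :
  (forall x, A x -> exists2 y, zgen A y & x ^+ 4 = x + 2 * y) ->
  forall x k, zgen A x -> exists2 y, zgen A y & x ^+ (4 ^ k) = x + 2 * y.
Proof.
move=> hA x k Sx; elim: k => [|k [y Sy Ey]].
  by exists 0; [exact: (zgen_nat _ 0) | rewrite expr1 mulr0 addr0].
have [t St Et] : exists2 t, zgen A t & (x ^+ (4 ^ k)) ^+ 4 = x ^+ (4 ^ k) + 2 * t.
  by apply: zgen_exp4 => //; apply: zgen_exp.
by exists (y + t); [exact: zgen_add | rewrite expnSr exprM Et Ey; ring].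
Qed.

Ltac integral_closure :=
  repeat first [ assumption | exact: integral1 | exact: integral_nat
               | apply: integral_sub | apply: integral_add | apply: integral_mul ].

(** * From the subring to all integers of the field *)

Section QuadraticIntegers.
Variable K : fieldExtType rat.

Lemma intr_ext_eq0 (z : int) : (z%:~R == 0 :> K) = (z == 0).
Proof. by rewrite -(rmorph_int (in_alg K)) fmorph_eq0 intr_eq0. Qed.

Lemma natr_ext_eq0 (n : nat) : (n%:R == 0 :> K) = (n == 0%N).
Proof. exact: (intr_ext_eq0 n). Qed.

(** Here e is the degree of a monic equation of d. Up to e, powers of 2 d suffice; beyond, the
    equation lowers the exponent. *)
Lemma integral_exp_bound (A : K -> Prop) (d : K) :
  algebraic_integer d -> zgen A (2 * d) ->
  exists e, forall j, zgen A (2 ^+ e * d ^+ j).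
Proof.
case=> p p_mon rootp Sd.
have [e sp] : exists e, size p = e.+1.
  by exists (size p).-1; rewrite prednK // lt0n size_poly_eq0 monic_neq0.
exists e; elim/ltn_ind=> j IH; case: (leqP j e) => [le_je|lt_ej].
  rewrite -(subnK le_je) exprD -mulrA -exprMn.
  by apply: zgen_mul; apply: zgen_exp => //; apply: zgen_nat.
have Ee : d ^+ e = - \sum_(i < e) (p`_i)%:~R * d ^+ i.
  move: rootp; rewrite rootE horner_coef size_map_poly_id0; last first.
    by rewrite (monicP p_mon) rmorph1 oner_eq0.
  rewrite sp big_ord_recr /= addrC addr_eq0 => /eqP.
  have lp : p`_e = 1 by move/monicP: p_mon; rewrite /lead_coef sp.
  rewrite coef_map /= lp mul1r => ->; congr (- _).
  by apply: eq_bigr => i _; rewrite coef_map.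
have -> : 2 ^+ e * d ^+ j =
    - \sum_(i < e) (p`_i)%:~R * (2 ^+ e * d ^+ (i + (j - e))).
  rewrite -[X in d ^+ X](subnKC (ltnW lt_ej)) exprD Ee mulNr mulrN mulr_suml mulr_sumr.
  by congr (- _); apply: eq_bigr => i _; rewrite exprD; ring.
apply: zgen_opp; apply: zgen_sum => i; apply: zgen_mul; first exact: zgen_int.
by apply: IH; have := ltn_ord i; lia.
Qed.

(** With no generators the subring is Z; for d = 1/2 the bound puts 2^e d^(e+1), which is 1/2, into
    Z. *)
Lemma two_not_unit (d : K) : algebraic_integer d -> 1 != 2 * d.
Proof.
move=> int_d; apply/eqP=> E.
have [|e /(_ e.+1)] := @integral_exp_bound (fun _ => False) d int_d.
  by rewrite -E; apply: (zgen_nat _ 1).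
have zP x : zgen (fun _ : K => False) x -> exists z : int, x = z%:~R.
  elim=> {x} [z|x []|x y _ [z ->] _ [t ->]|x y _ [z ->] _ [t ->]].
  - by exists z.
  - by exists (z + t); rewrite rmorphD.
  - by exists (z * t); rewrite rmorphM.
case/zP=> z Ez.
have : (2 * z - 1)%:~R == 0 :> K.
  have E1 : (2 * d) ^+ e.+1 = 1 by rewrite -E expr1n.
  rewrite exprMn exprS -mulrA Ez in E1.
  by apply/eqP; rewrite rmorphB rmorphM /= [_ * _]E1 subrr.
by rewrite intr_ext_eq0; lia.
Qed.

(** Modulo 2 the element 2 d equals its power of exponent 4^e. That power is 2^(4^e) d^(4^e), and as
    e < 4^e the bound on denominators leaves a factor 2 to spare. *)
Lemma zgen_two_saturated (A : K -> Prop) :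
  (forall x, A x -> exists2 y, zgen A y & x ^+ 4 = x + 2 * y) ->
  forall d, algebraic_integer d -> zgen A (2 * d) -> zgen A d.
Proof.
move=> hA d int_d Sd; have [e he] := integral_exp_bound int_d Sd.
have [y Sy Ey] := zgen_exp4X hA e Sd.
have lt_e : (e < 4 ^ e)%N by rewrite ltn_expl.
have -> : d = 2 ^+ (4 ^ e - e.+1) * (2 ^+ e * d ^+ (4 ^ e)) - y.
  have n2 : 2%:R != 0 :> K by rewrite natr_ext_eq0.
  apply: (mulfI n2); rewrite mulrBr !mulrA -exprS -exprD.
  have -> : ((4 ^ e - e.+1).+1 + e = 4 ^ e)%N by lia.
  by rewrite -exprMn Ey addrK.
apply: zgen_add; last exact: zgen_opp.
by apply: zgen_mul => //; apply: zgen_exp; apply: zgen_nat.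
Qed.

Lemma zgen_odd_denominator (A : K -> Prop) :
  (forall x, A x -> exists2 y, zgen A y & x ^+ 4 = x + 2 * y) ->
  forall (N : nat) (x : K), algebraic_integer x -> (0 < N)%N -> zgen A (N%:R * x) ->
  exists2 M, odd M & zgen A (M%:R * x).
Proof.
move=> hA; elim/ltn_ind=> N IH x int_x N0 SN.
case: (boolP (odd N)) => N_odd; first by exists N.
have EN : N = (2 * N./2)%N by rewrite mul2n even_halfK.
apply: (IH N./2) => //; [lia..|].
apply: zgen_two_saturated => //; last by rewrite mulrA -natrM -EN.
by apply: integral_mul => //; apply: integral_nat.
Qed.

Lemma zgen_integral (A : K -> Prop) :
  (forall x, A x -> algebraic_integer x) -> forall x, zgen A x -> algebraic_integer x.
Proof.
move=> hA x; elim=> {x} [z|x /hA //|x y _ ? _ ?|x y _ ? _ ?].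
- exact: integral_id.
- exact: integral_add.
- exact: integral_mul.
Qed.

(** Elements of E(a) are polynomials in a over E, and denominators of finitely many terms have a
    common multiple. *)
Lemma Fadjoin_denominator (A : K -> Prop) (E : {subfield K}) (a : K) :
  (exists2 N, (0 < N)%N & zgen A (N%:R * a)) ->
  (forall x, x \in E -> exists2 N, (0 < N)%N & zgen A (N%:R * x)) ->
  forall x, x \in <<E; a>>%VS -> exists2 N, (0 < N)%N & zgen A (N%:R * x).
Proof.
move=> ha hE x /Fadjoin_polyP[p /polyOverP pE ->].
have hM y z : (exists2 N, (0 < N)%N & zgen A (N%:R * y)) ->
  (exists2 N, (0 < N)%N & zgen A (N%:R * z)) ->
  (exists2 N, (0 < N)%N & zgen A (N%:R * (y * z))).
  move=> [N N0 SN] [M M0 SM]; exists (N * M)%N; first by rewrite muln_gt0 N0.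
  by rewrite natrM mulrACA; apply: zgen_mul.
have hX n : exists2 N, (0 < N)%N & zgen A (N%:R * a ^+ n).
  elim: n => [|n IH]; last by rewrite exprS; apply: hM.
  by exists 1%N => //; rewrite expr0 mulr1; apply: zgen_nat.
rewrite horner_coef; apply: (big_ind (fun y => exists2 N, (0 < N)%N & zgen A (N%:R * y))).
- by exists 1%N => //; rewrite mulr0; apply: (zgen_nat _ 0).
- move=> y z [N N0 SN] [M M0 SM]; exists (N * M)%N; first by rewrite muln_gt0 N0.
  have -> : (N * M)%:R * (y + z) = M%:R * (N%:R * y) + N%:R * (M%:R * z).
    by rewrite natrM; ring.
  by apply: zgen_add; apply: zgen_mul => //; apply: zgen_nat.
- by move=> i _; apply: hM; [apply: hE; apply: pE | apply: hX].
Qed.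

Lemma one_denominator (A : K -> Prop) (x : K) :
  x \in 1%VS -> exists2 N, (0 < N)%N & zgen A (N%:R * x).
Proof.
case/vlineP=> c ->; exists (absz (denq c)); first by rewrite absz_gt0 denq_neq0.
have -> : (absz (denq c))%:R * (c *: 1) = (numq c)%:~R :> K.
  rewrite -(rmorph_nat (in_alg K)) -(rmorph_int (in_alg K)) -[c *: 1]/(in_alg K c) -rmorphM.
  congr (in_alg K _); rewrite numqE mulrC; congr (_ * _).
  by rewrite -[(absz _)%:R]/((absz (denq c))%:Z%:~R) absz_denq.
exact: zgen_int.
Qed.

(** An odd multiple r = M x lies in the subring and is congruent to x modulo 2, so the congruence
    for r passes to x. *)
Lemma integral_exp4 (A : K -> Prop) :
  (forall x, A x -> algebraic_integer x) ->
  (forall x, A x -> exists2 y, zgen A y & x ^+ 4 = x + 2 * y) ->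
  (forall x : K, exists2 N, (0 < N)%N & zgen A (N%:R * x)) ->
  forall x : K, algebraic_integer x ->
    exists2 y, algebraic_integer y & x ^+ 4 = x + 2 * y.
Proof.
move=> intA hA denA x int_x; have [N N0 SN] := denA x.
have [M M_odd SM] := zgen_odd_denominator hA int_x N0 SN.
have [t St Et] := zgen_exp4 hA SM.
have int_r := zgen_integral intA SM; have int_t := zgen_integral intA St.
pose w : K := M./2%:R * x; pose r : K := M%:R * x.
have int_w : algebraic_integer w by apply: integral_mul => //; apply: integral_nat.
have Ex : x = r - 2 * w.
  have EM : M = (1 + 2 * M./2)%N by have := odd_double_half M; rewrite M_odd; lia.
  by rewrite /r {1}EM natrD natrM /w; ring.
exists (t + w + (12 * r ^+ 2 * w ^+ 2 - 4 * r ^+ 3 * w - 16 * r * w ^+ 3 + 8 * w ^+ 4)).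
  by rewrite !exprS !expr0; integral_closure.
have -> : x ^+ 4 = r ^+ 4 + 2 * (12 * r ^+ 2 * w ^+ 2 - 4 * r ^+ 3 * w
                                 - 16 * r * w ^+ 3 + 8 * w ^+ 4).
  by rewrite Ex; ring.
by rewrite [r ^+ 4]Et -/r {1}Ex; ring.
Qed.

(** * Sums of three squares and of two squares *)

(* With w = (1 + 2ab(s-1), -b(s-1), -a(s-1)) and s = x^2, the sum of squares of w
   is s^2 = x modulo 2, and translating w by t (1, a, b), an isotropic vector,
   changes this sum by 2t. *)
Lemma sum_three_squares (a b : K) :
  algebraic_integer a -> algebraic_integer b -> a ^+ 2 + b ^+ 2 = -1 ->
  (forall x : K, algebraic_integer x ->
    exists2 y, algebraic_integer y & x ^+ 4 = x + 2 * y) ->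
  all_integers_sums_of K 3.
Proof.
move=> int_a int_b Eab frob x int_x; have [y int_y Ey] := frob x int_x.
pose s := x * x - 1.
have int_s : algebraic_integer s.
  by apply: integral_sub; [apply: integral_mul | apply: integral1].
pose c := a * b * s.
have int_c : algebraic_integer c by integral_closure.
(* Half the difference between x and the sum of squares of w, computed with x^4 = x + 2 y. *)
pose t := x + y - x * x - 2 * c - 2 * (c * c).
have int2 : algebraic_integer (2 : K) by apply: integral_nat.
have int_t : algebraic_integer t.
  by integral_closure.
exists (fun i : 'I_3 => [:: 1 + 2 * c + t; a * t - b * s; b * t - a * s]`_i); split.
  case=> [] [|[|[|i]]] //= _.
  - by integral_closure.
  - by integral_closure.
  - by integral_closure.
rewrite !big_ord_recl big_ord0 /= addr0.
have -> : (1 + 2 * c + t) ^+ 2 + ((a * t - b * s) ^+ 2 + (b * t - a * s) ^+ 2) =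
    (1 + 2 * c) ^+ 2 + 2 * t + (1 + (a ^+ 2 + b ^+ 2)) * t ^+ 2 + (a ^+ 2 + b ^+ 2) * s ^+ 2.
  by rewrite /c; ring.
rewrite Eab subrr mul0r addr0 mulN1r /t /s.
have -> : (1 + 2 * c) ^+ 2 + 2 * (x + y - x * x - 2 * c - 2 * (c * c)) - (x * x - 1) ^+ 2
   = x + (x + 2 * y - x ^+ 4) by ring.
by rewrite Ey subrr addr0.
Qed.

(* If 1 + 2 th = y^2 + z^2 then y + z = 1 mod 2, so th = y^2 - y mod 2 and
   th^2 + th = y^4 - y = 0 mod 2. *)
Lemma not_sum_two_squares (th : K) (h : nat) :
  algebraic_integer th -> th ^+ 2 + th = - (2 * h + 1)%:R ->
  (forall x : K, algebraic_integer x ->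
    exists2 y, algebraic_integer y & x ^+ 4 = x + 2 * y) ->
  forall y z : K, algebraic_integer y -> algebraic_integer z ->
    1 + 2 * th <> y ^+ 2 + z ^+ 2.
Proof.
move=> int_th Eth frob y z int_y int_z E.
have int2 : algebraic_integer (2 : K) by apply: integral_nat.
have int1 : algebraic_integer (1 : K) by apply: integral1.
have inth : algebraic_integer (h%:R : K) by apply: integral_nat.
have [t int_t Et] := frob (y + z) (integral_add int_y int_z).
have [v int_v Ev] := frob y int_y.
(* Squaring (y + z)^2 = 1 + 2 g and comparing with (y + z)^4 = y + z + 2 t gives y + z = 1 + 2 d. *)
pose g := th + y * z; pose d := 2 * g + 2 * (g * g) - t.
have int_g : algebraic_integer g by apply: integral_add => //; apply: integral_mul.
have int_d : algebraic_integer d.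
  by integral_closure.
have n2 : 2%:R != 0 :> K by rewrite natr_ext_eq0.
have Eg : (y + z) ^+ 2 = 1 + 2 * g.
  have -> : (y + z) ^+ 2 = y ^+ 2 + z ^+ 2 + 2 * (y * z) by ring.
  by rewrite -E /g; ring.
have Ez : z = 1 + 2 * d - y.
  have -> : z = y + z + 2 * t - 2 * t - y by ring.
  by rewrite -Et -[4%N]/(2 * 2)%N exprM Eg /d; ring.
pose e := d + d * d - y * d.
have int_e : algebraic_integer e.
  by integral_closure.
have Ee : th = y ^+ 2 - y + 2 * e.
  apply: (mulfI n2); apply: (addrI 1); rewrite E Ez /e; ring.
(* Half of th^2 + th + 2h + 2, which equals 1 by the equation of th. *)
pose f := v - y * (y * y) + y * y + 2 * e * (y * y - y) + 2 * (e * e) + e + h%:R + 1.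
have int_f : algebraic_integer f.
  by integral_closure.
apply/negP: (two_not_unit int_f); rewrite negbK; apply/eqP.
have -> : 2 * f = y + 2 * v - y ^+ 4 + (th ^+ 2 + th) + (2 * h%:R + 2).
  by rewrite Ee /f; ring.
by rewrite -Ev subrr add0r Eth natrD natrM; ring.
Qed.

Lemma integral_artin_schreier (x : K) (c : int) :
  x ^+ 2 + x = c%:~R -> algebraic_integer x.
Proof.
move=> E; exists ('X^2 + ('X - c%:P)).
  by rewrite monicE lead_coefDl ?lead_coefXn // size_polyXn size_XsubC.
rewrite rootE !rmorphD rmorphN /= map_polyXn map_polyX map_polyC /= !hornerE -E.
exact/eqP/subrr.
Qed.

(** Modulo 2, x^2 = x + c and c^2 = c, hence x^4 = x^2 + c = x. *)
Lemma exp4_artin_schreier (A : K -> Prop) (x : K) (c : int) :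
  zgen A x -> x ^+ 2 + x = c%:~R -> exists2 y, zgen A y & x ^+ 4 = x + 2 * y.
Proof.
move=> Sx H; have E : x ^+ 2 = c%:~R - x by rewrite -H addrK.
have [w Ew] : exists w : int, c * c + c = 2 * w.
  have [t [->|->]] : exists t : int, c = 2 * t \/ c = 2 * t + 1.
  + by exists (c %/ 2)%Z; lia.
  + by exists (2 * t ^+ 2 + t); ring.
  + by exists (2 * t ^+ 2 + 3 * t + 1); ring.
have {}Ew : c%:~R * c%:~R + c%:~R = 2 * w%:~R :> K.
  by rewrite -intrM -intrD Ew intrM.
exists (w%:~R + - (c%:~R * x) + - x).
  by apply: zgen_add; [apply: zgen_add; [exact: zgen_int | apply: zgen_opp] | apply: zgen_opp];
     [apply: zgen_mul => //; exact: zgen_int | ].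
rewrite -[4%N]/(2 * 2)%N exprM E.
have -> : (c%:~R - x) ^+ 2 = c%:~R * c%:~R - 2 * (c%:~R * x) + x ^+ 2 by ring.
rewrite E.
have -> : x + 2 * (w%:~R - c%:~R * x - x) = 2 * w%:~R - 2 * (c%:~R * x) - x by ring.
by rewrite -Ew; ring.
Qed.

(** * The biquadratic field and the three cases *)

Lemma g_integers_eq3 (m n : nat) :
  m = 3 %[mod 8] -> n = 1 %[mod 4] -> two_split m ->
  generated_by_sqrts K (- m%:R) n%:R -> g_integers_eq K 3.
Proof.
move=> m8 n4 [x [y [x_odd y_odd Exy]]] [u [v [Eu Ev gen]]].
(* For m = 3 modulo 8, (m + 1)/4 is odd; this parity drives the lower bound. *)
have [h Em] : exists h, m = (4 * (2 * h + 1) - 1)%N by exists (m %/ 8)%N; lia.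
have [l En] : exists l, n = (4 * l + 1)%N by exists (n %/ 4)%N; lia.
have n2 : 2%:R != 0 :> K by rewrite natr_ext_eq0.
have n4' : 4%:R != 0 :> K by rewrite natr_ext_eq0.
have {}Eu : u ^+ 2 = - m%:R by rewrite Eu scaleNr scaler_nat.
have {}Ev : v ^+ 2 = n%:R by rewrite Ev scaler_nat.
pose th : K := (u - 1) / 2; pose ph : K := (v - 1) / 2.
have Euth : u = 1 + 2 * th by rewrite /th mulrC divfK // addrC subrK.
have Evph : v = 1 + 2 * ph by rewrite /ph mulrC divfK // addrC subrK.
have Eth : th ^+ 2 + th = - (2 * h + 1)%:R.
  apply: (mulfI n4'); have -> : 4 * (th ^+ 2 + th) = u ^+ 2 - 1 by rewrite Euth; ring.
  have -> : u ^+ 2 = 1 - (4 * (2 * h + 1))%:R.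
    have -> : (4 * (2 * h + 1))%N = (m + 1)%N by lia.
    by rewrite Eu natrD; ring.
  by rewrite natrM; ring.
have Eph : ph ^+ 2 + ph = l%:R.
  apply: (mulfI n4'); have -> : 4 * (ph ^+ 2 + ph) = v ^+ 2 - 1 by rewrite Evph; ring.
  by rewrite Ev En natrD natrM; ring.
pose A z := z = th \/ z = ph.
have Eth' : th ^+ 2 + th = (- (2 * h + 1)%:Z)%:~R by rewrite Eth rmorphN.
have Eph' : ph ^+ 2 + ph = l%:Z%:~R by rewrite Eph.
have Sth : zgen A th by apply: zgen_base; left.
have Sph : zgen A ph by apply: zgen_base; right.
have intA z : A z -> algebraic_integer z.
  by case=> ->; [apply: integral_artin_schreier Eth' | apply: integral_artin_schreier Eph'].
have hA z : A z -> exists2 t, zgen A t & z ^+ 4 = z + 2 * t.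
  by case=> ->; [apply: exp4_artin_schreier Eth' | apply: exp4_artin_schreier Eph'].
have den2 z : zgen A z -> exists2 N, (0 < N)%N & zgen A (N%:R * (1 + 2 * z)).
  move=> Sz; exists 1%N => //; rewrite mul1r.
  by apply: zgen_add; [exact: (zgen_nat _ 1) | apply: zgen_mul => //; exact: zgen_nat].
have denA z : exists2 N, (0 < N)%N & zgen A (N%:R * z).
  have : z \in << <<1; u>>; v>>%VS.
    by rewrite -adjoin_seq1 -adjoin_cons gen memvf.
  apply: Fadjoin_denominator; first by rewrite Evph; apply: den2.
  apply: Fadjoin_denominator; first by rewrite Euth; apply: den2.
  exact: one_denominator.
have frob := integral_exp4 intA hA denA.
have int_th : algebraic_integer th by apply: intA; left.
split=> //.
(* These are (y u + x)/2 and (y u - x)/2, written through th so that integrality is visible. *)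
- pose a : K := y./2%:R + x./2%:R + 1 + y%:R * th.
  pose b : K := y./2%:R - x./2%:R + y%:R * th.
  have Ey : y%:R = 1 + 2 * y./2%:R :> K.
    by rewrite -[in LHS](odd_double_half y) y_odd natrD -mul2n natrM.
  have Ex : x%:R = 1 + 2 * x./2%:R :> K.
    by rewrite -[in LHS](odd_double_half x) x_odd natrD -mul2n natrM.
  have Ea : 2 * a = y%:R * u + x%:R.
    by rewrite /a Euth Ey Ex; ring.
  have Eb : 2 * b = y%:R * u - x%:R.
    by rewrite /b Euth Ey Ex; ring.
  apply: (@sum_three_squares a b) => //.
  + by integral_closure.
  + by integral_closure.
  + apply: (mulfI n4').
    have -> : 4 * (a ^+ 2 + b ^+ 2) = (2 * a) ^+ 2 + (2 * b) ^+ 2 by ring.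
    rewrite Ea Eb.
    have -> : (y%:R * u + x%:R) ^+ 2 + (y%:R * u - x%:R) ^+ 2 =
       2 * (x ^ 2 + 2)%:R - 4 + 2 * (y%:R ^+ 2 * u ^+ 2) :> K by rewrite natrD natrX; ring.
    by rewrite Eu -Exy natrM natrX; ring.
(* The witness against fewer than three squares is u = 1 + 2 th; a single square is padded with
   0. *)
- move=> s s0 /(_ u); have int_u : algebraic_integer u.
    rewrite Euth; apply: integral_add; first exact: integral1.
    by apply: integral_mul => //; apply: integral_nat.
  case/(_ int_u)=> f [int_f Ef]; rewrite leqNgt; apply/negP=> lt_s3.
  have nsum := not_sum_two_squares int_th Eth frob.
  case: s s0 lt_s3 f int_f Ef => [|[|[|s]]] // _ _ f int_f.
  + rewrite big_ord_recl big_ord0 Euth => Ef.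
    apply: (nsum (f ord0) 0) => //; first exact: integral0.
    by rewrite Ef expr0n.
  + rewrite !big_ord_recl big_ord0 addr0 Euth.
    exact: nsum.
Qed.

End QuadraticIntegers.

Theorem theorem1p3 (m n : nat) (K : fieldExtType rat)
    (m_gt0 : (0 < m)%N) (n_gt0 : (0 < n)%N) (neq_mn : m <> n)
    (m_mod4 : m = 3 %[mod 4]) (n_mod4 : n = 1 %[mod 4])
    (m_sqf : squarefree m) (n_sqf : squarefree n)
    (defK : generated_by_sqrts K (- m%:R) n%:R) :
  [/\ (* (I) *)
      forall p : nat, prime p -> m = p -> p = 3 %[mod 8] ->
        g_integers_eq K 3,
      (* (II) *)
      forall p q : nat, prime p -> prime q -> p <> q ->
        m = (p * q)%N -> p = 3 %[mod 8] -> q = 1 %[mod 8] ->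
        legendre p q = -1 ->
        g_integers_eq K 3
    & (* (III) *)
      forall p q r : nat, prime p -> prime q -> prime r ->
        p <> q -> q <> r -> p <> r ->
        m = (p * q * r)%N ->
        p = 3 %[mod 8] -> q = 3 %[mod 8] -> r = 3 %[mod 8] ->
        legendre p q = -1 -> legendre q r = -1 -> legendre r p = -1 ->
        g_integers_eq K 3].
Proof.
split=> [p p_pr Em p8|p q p_pr q_pr _ Em p8 q8 Lpq
        |p q r p_pr q_pr r_pr _ _ _ Em p8 q8 r8 Lpq Lqr Lrp];
  apply: g_integers_eq3 n_mod4 _ defK; rewrite Em.
- exact: p8.
- exact: two_split_prime.
- by rewrite -modnMm p8 q8.
- by apply: two_split_mul => //; apply: legendre_nonsquare.
- by rewrite -modnMm -[((p * q) %% 8)%N]modnMm p8 q8 r8.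
- by apply: two_split_mul3 => //; apply: legendre_nonsquare.
Qed.
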